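(* Let $n\geq 1$. A word over the alphabet $[n]$ fixes the family $F_{A\Gamma}(n)$ of all $n$-component asynchronous-acyclic networks if and only if it is $n$-path-universal; thus \[ \lambda_{A\Gamma}(n)=\Lambda(n). \] Moreover, \[ \max_{f\in F_{A\Gamma}(n)}\lambda(f)=2^n-1. \]
   Context: Let $[n]=\{1,\dots,n\}$. An $n$-component (Boolean) network is a function $f:\{0,1\}^n\to\{0,1\}^n$, $f(x)=(f_1(x),\dots,f_n(x))$. For $i\in[n]$ and $x\in\{0,1\}^n$, let $f^i(x):=(x_1,\dots,x_{i-1},f_i(x),x_{i+1},\dots,x_n)$. For a word $w=i_1i_2\dots i_k$ over $[n]$, let $f^w:=f^{i_k}\circ f^{i_{k-1}}\circ\dots\circ f^{i_1}$ (the identity if $w$ is empty). A word $w$ fixes $f$ if $f^w(x)$ is a fixed point of $f$ for every $x\in\{0,1\}^n$; $f$ is fixable if some word fixes it, and then $\lambda(f)$ (the fixing length of $f$) is the minimum length of a word fixing $f$. A word fixes a family of networks if it fixes every member of the family. The asynchronous graph $\Gamma(f)$ is the directed graph with vertex set $\{0,1\}^n$ having an arc from $x$ to $y$ if and only if $x$ and $y$ differ in exactly one component, say $i$, and $f_i(x)\neq x_i$. A network $f$ is asynchronous-acyclic if $\Gamma(f)$ is acyclic (has no directed cycle); every such network is fixable. $F_{A\Gamma}(n)$ is the family of all $n$-component asynchronous-acyclic networks, and $\lambda_{A\Gamma}(n)$ is the minimum length of a word fixing $F_{A\Gamma}(n)$. The $n$-cube is the graph on $\{0,1\}^n$ in which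 two vertices are adjacent when they differ in exactly one component. Given a path $P=x^1x^2\dots x^l$ of the $n$-cube (without repeated vertices), let $i_k$ be the component in which $x^k$ and $x^{k+1}$ differ, $1\leq k<l$; the word $i_1i_2\dots i_{l-1}$ is the word induced by $P$. An $n$-path-word is a word induced by at least one path of the $n$-cube. A word $u=u_1\dots u_q$ is a subword of $w=w_1\dots w_p$ if there exist $1\leq i_1<\dots<i_q\leq p$ with $u=w_{i_1}\dots w_{i_q}$ (not necessarily consecutive positions). A word over $[n]$ is $n$-path-universal if it contains all $n$-path-words as subwords. $\Lambda(n)$ is the minimum length of an $n$-path-universal word. *)

(* Defs.v *)
From mathcomp Require Import all_boot.
Set Implicit Arguments.
Unset Strict Implicit.
Unset Printing Implicit Defensive.

(* The component set [n] is 'I_n, i.e. {0, .., n-1}. *)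

Definition state (n : nat) := {ffun 'I_n -> bool}.
Definition network (n : nat) := state n -> state n.
Definition word (n : nat) := seq 'I_n.

(* f^i *)
Definition update n (f : network n) (i : 'I_n) (x : state n) : state n :=
  [ffun j => if j == i then f x i else x j].

(* The map f^w; the leftmost letter of w acts first. *)
Definition run n (f : network n) (w : word n) (x : state n) : state n :=
  foldl (fun y i => update f i y) x w.

Definition fixes n (w : word n) (f : network n) : Prop :=
  forall x : state n, f (run f w x) = run f w x.

Definition fixes_family n (w : word n) (F : network n -> Prop) : Prop :=
  forall f : network n, F f -> fixes w f.

Definition is_min (P : nat -> Prop) (m : nat) : Prop :=
  P m /\ forall k, P k -> m <= k.

Definition is_max (P : nat -> Prop) (m : nat) : Prop :=
  P m /\ forall k, P k -> k <= m.

Definition min_length n (P : word n -> Prop) : nat -> Prop :=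
  is_min (fun k => exists2 w : word n, P w & size w = k).

(* fixing_length f m reads "f is fixable and lambda(f) = m". *)
Definition fixing_length n (f : network n) : nat -> Prop :=
  min_length (fun w => fixes w f).

(* x and y differ in component i and in no other. *)
Definition differ_only_at n (i : 'I_n) (x y : state n) : bool :=
  [forall j, (x j != y j) == (j == i)].

Definition cube_adj n : rel (state n) :=
  fun x y => [exists i, differ_only_at i x y].

Definition async_arc n (f : network n) : rel (state n) :=
  fun x y => [exists i, differ_only_at i x y && (f x i != x i)].

(* The family F_AGamma(n).  A directed cycle is a nonempty cyclic sequence of
   pairwise distinct states; cycles of length 2 are included. *)
Definition async_acyclic n (f : network n) : Prop :=
  forall c : seq (state n), ucycle (async_arc f) c -> c = [::].

(* w is induced by the sequence of states x :: p: the k-th letter of w is the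
   component in which the k-th and (k+1)-st states differ (all2 also forces
   size w = size p). *)
Definition induced_word n (x : state n) (p : seq (state n)) (w : word n) : bool :=
  all2 (fun i e => differ_only_at i e.1 e.2) w (pairmap pair x p).

Definition path_word n (w : word n) : Prop :=
  exists (x : state n) (p : seq (state n)),
    [/\ path (@cube_adj n) x p, uniq (x :: p) & induced_word x p w].

Definition path_universal n (w : word n) : Prop :=
  forall u : word n, path_word u -> subseq u w.

(* The values lambda_AGamma(n) and Lambda(n), as "is the minimum" relations. *)
Definition lambda_AG (n : nat) : nat -> Prop :=
  min_length (fun w : word n => fixes_family w (@async_acyclic n)).

Definition Lambda (n : nat) : nat -> Prop := min_length (@path_universal n).

(* Main.v *)
(* Reading a word, the letters that change the state of an asynchronous-acyclic
   network trace a path of its asynchronous graph, and each of them is read at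
   its first possible position; so, if the run stopped at a state with an active
   component i, the path-word of the trace followed by i would not be a subword.
   Conversely, the network moving each vertex of a path to the next one, and
   fixing all other states, is asynchronous-acyclic, and a word fixing it
   contains the word induced by the path.  Applied to a Gray code this yields
   the lower bound 2^n - 1; for the upper bound, empty the set of non-fixed
   states one state at a time, following a topological order. *)
Require Import Defs.
From mathcomp Require Import all_boot.
From Stdlib Require Import Classical Wf_nat.
Set Implicit Arguments.
Unset Strict Implicit.
Unset Printing Implicit Defensive.

(** * Cycles and ranks in directed graphs *)

Lemma ucycle_closed_path (T : eqType) (e : rel T) (x : T) (p : seq T) :
  path e x p -> p != [::] -> last x p = x -> exists2 c, ucycle e c & c != [::].
Proof.
case: p => [//|y p] /= /andP[exy] /shortenP[q eq uq _] _ lastq.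
by exists (y :: q) => //; rewrite /ucycle uq andbT (cycle_path x) /= lastq exy.
Qed.

(** A repeated vertex would cut out a closed walk, and shortening that walk gives a cycle. *)
Lemma acyclic_path_uniq (T : eqType) (e : rel T) (x : T) (p : seq T) :
  (forall c, ucycle e c -> c = [::]) -> path e x p -> uniq (x :: p).
Proof.
move=> acyc; elim: p x => [//|y p IH] x exyp.
have [_ eyp] := andP exyp.
rewrite cons_uniq (IH y eyp) andbT; apply/negP => x_in.
case/path.splitP: x_in exyp => p1 p2; rewrite cat_path => /andP[exp1 _].
have [||c /acyc -> //] := ucycle_closed_path exp1; last by rewrite last_rcons.
by case: (p1).
Qed.

Lemma increasing_acyclic (T : eqType) (e : rel T) (r : T -> nat) :
  (forall x y, e x y -> r x < r y) -> forall c, ucycle e c -> c = [::].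
Proof.
move=> r_incr [//|x c] /andP[/= ec _].
have/(order_path_min ltn_trans): path ltn (r x) [seq r y | y <- rcons c x].
  by rewrite path_map; apply: sub_path ec.
by rewrite map_rcons all_rcons /= ltnn.
Qed.

(** The rank counts ancestors: along an arc from [x] to [y] those of [x] are kept, and [y] is new,
    since a path from [y] back to [x] would close a cycle. *)
Lemma acyclic_rank (T : finType) (e : rel T) :
  (forall c, ucycle e c -> c = [::]) ->
  exists r : T -> nat, forall x y, e x y -> r x < r y.
Proof.
move=> acyc; exists (fun y => #|[set z | connect e z y]|) => x y exy.
apply: proper_card; apply/properP; split.
  apply/subsetP => z; rewrite !inE => /connect_trans; apply.
  exact: connect1.
exists y; rewrite !inE ?connect0 //; apply/negP => /connectP[p eyp lastp].
have := @ucycle_closed_path _ e x (y :: p).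
by rewrite /= exy eyp -lastp => -[] // c /acyc ->.
Qed.

Lemma exists_least (P : nat -> Prop) :
  (exists k, P k) -> exists m, is_min P m.
Proof.
case=> k Pk.
(* [P] is arbitrary, so excluded middle supplies its decidability. *)
have [m [[Pm least_m] _]] := dec_inh_nat_subset_has_unique_least_element P
  (fun k => classic (P k)) (ex_intro _ k Pk).
by exists m; split=> // j /least_m /leP.
Qed.

Section Networks.
Variable n : nat.
Implicit Types (f : network n) (x y : state n) (p : seq (state n)).
Implicit Types (i j : 'I_n) (u w : word n).

(** * Flips, arcs and induced words *)

Definition flip i x : state n := [ffun j => x j (+) (j == i)].

Lemma flipK i : involutive (flip i).
Proof. by move=> x; apply/ffunP => j; rewrite !ffunE -addbA addbb addbF. Qed.

Lemma flip_inj_letter i j x : flip i x = flip j x -> i = j.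
Proof.
move/ffunP/(_ i); rewrite !ffunE eqxx => /addbI.
by move=> /esym/eqP.
Qed.

Lemma differ_only_atP i x y : reflect (y = flip i x) (differ_only_at i x y).
Proof.
apply: (iffP forallP) => [h | -> j].
  apply/ffunP => j; rewrite ffunE -(eqP (h j)).
  by case: (x j) (y j) => [] [].
by rewrite ffunE; case: (x j) (j == i) => [] [].
Qed.

Lemma async_arcP f x y :
  reflect (exists2 i, f x i != x i & y = flip i x) (async_arc f x y).
Proof.
apply: (iffP existsP) => [[i /andP[/differ_only_atP ? ?]] | [i ? ->]].
  by exists i.
by exists i; apply/andP; split=> //; apply/differ_only_atP.
Qed.

Lemma cube_adjP x y : reflect (exists i, y = flip i x) (cube_adj x y).
Proof.
by apply: (iffP existsP) => -[i /differ_only_atP ?]; exists i.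
Qed.

Lemma updateE f i x :
  update f i x = if f x i == x i then x else flip i x.
Proof.
apply/ffunP => j; rewrite ffunE; case: eqP => [->|ne].
  by case: eqP => [->|/eqP]; rewrite ?ffunE ?eqxx //; case: (f x i) (x i) => [] [].
by case: ifP => // _; rewrite ffunE (introF eqP ne) addbF.
Qed.

Lemma nonfixedP f x : reflect (exists i, f x i != x i) (f x != x).
Proof.
apply: (iffP idP) => [ne | [i]]; last by apply: contraNneq => ->.
apply/existsP; apply: contraNT ne; rewrite negb_exists => /forallP h.
by apply/eqP/ffunP => i; apply/eqP; rewrite -[_ == _]negbK.
Qed.

Lemma update_fixed f i x : f x = x -> update f i x = x.
Proof. by move=> fx; rewrite updateE fx eqxx. Qed.

Lemma induced_word_size x p u : induced_word x p u -> size u = size p.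
Proof. by rewrite /induced_word all2E size_pairmap => /andP[/eqP]. Qed.

Lemma induced_word_cons x y p i u :
  induced_word x (y :: p) (i :: u) = differ_only_at i x y && induced_word y p u.
Proof. by []. Qed.

Lemma cube_path_induced x p :
  path (@cube_adj n) x p -> exists u, induced_word x p u.
Proof.
elim: p x => [|y p IH] x /=; first by exists [::].
move=> /andP[/existsP[i xiy] /IH[u yu]].
by exists (i :: u); rewrite induced_word_cons xiy.
Qed.

(** * Fixing words and path-universal words *)

Lemma run_trace f w x :
  exists p u,
    [/\ path (async_arc f) x p, induced_word x p u, last x p = run f w x
      & forall i, f (run f w x) i != run f w x i -> ~~ subseq (rcons u i) w].
Proof.
elim: w x => [|a w IH] x /=.
  by exists [::], [::]; split=> // i _; apply/eqP.
rewrite updateE; case: eqP => [fxa | /eqP fxa].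
  have [p [u [xp xu lastp maxu]]] := IH x.
  exists p, u; split=> // i acti.
  (* The skipped letter [a] is inactive at [x], whereas the first letter of [rcons u i] is active
     there: it labels the first arc of the trace, or is [i] if the run never leaves [x]. *)
  suff: head i u != a.
    by have := maxu i acti; case: (u) => [|b v] /= h /negbTE ->.
  case: p u xp xu lastp {maxu} => [|y p] [|b u] //=.
    by move=> _ _ lastp; apply: contraNneq acti => ->; rewrite -lastp fxa.
  move=> /andP[/async_arcP[j fxj ->] _].
  rewrite induced_word_cons => /andP[/differ_only_atP/flip_inj_letter <- _] _.
  by apply: contraNneq fxj => ->; rewrite fxa.
have [p [u [xp xu lastp maxu]]] := IH (flip a x).
exists (flip a x :: p), (a :: u); split=> //=.
- by rewrite xp andbT; apply/async_arcP; exists a.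
- by rewrite induced_word_cons xu andbT; apply/differ_only_atP.
- by move=> i; rewrite eqxx; apply: maxu.
Qed.

Lemma async_arc_cube_adj f : subrel (async_arc f) (@cube_adj n).
Proof. by move=> x y /existsP[i /andP[xiy _]]; apply/existsP; exists i. Qed.

Lemma induced_word_rcons x p u i :
  induced_word x p u ->
  induced_word x (rcons p (flip i (last x p))) (rcons u i).
Proof.
elim: p x u => [|y p IH] x [|j u] //=.
  by rewrite induced_word_cons andbT => _; apply/differ_only_atP.
by rewrite !induced_word_cons => /andP[-> /IH].
Qed.

Lemma path_universal_fixes w f :
  path_universal w -> async_acyclic f -> fixes w f.
Proof.
move=> univ acyc x; apply/eqP/negPn/negP => /nonfixedP[i acti].
have [p [u [xp xu lastp maxu]]] := run_trace f w x.
move: (maxu i acti); rewrite univ //.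
pose q := rcons p (flip i (last x p)).
have xq : path (async_arc f) x q.
  by rewrite rcons_path xp /=; apply/async_arcP; exists i; rewrite ?lastp.
exists x, q; split.
- exact: sub_path (@async_arc_cube_adj f) _ _ xq.
- exact: acyclic_path_uniq acyc xq.
- exact: induced_word_rcons.
Qed.

(* The last vertex of the path has index [size p], where [nth] takes its default
   value [z]: it is fixed. *)
Definition path_network x p : network n :=
  fun z => if z \in x :: p then nth z p (index z (x :: p)) else z.

Lemma path_network_fpath x p :
  uniq (x :: p) -> fpath (path_network x p) x p.
Proof.
move=> uxp; apply/(pathP x) => k ltk.
have ltk' : k < size (x :: p) by rewrite ltnS ltnW.
apply/eqP; rewrite /path_network mem_nth // index_uniq //.
exact: set_nth_default.
Qed.

(** Every arc goes from a vertex of the path to its successor, so the index along the path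
    increases. *)
Lemma path_network_acyclic x p :
  path (@cube_adj n) x p -> uniq (x :: p) ->
  async_acyclic (path_network x p).
Proof.
move=> xp uxp; apply: (increasing_acyclic (r := index^~ (x :: p))) => z z'.
case/async_arcP=> i; rewrite /path_network; case: ifP => [z_in|]; last first.
  by rewrite eqxx.
set k := index z _; have [ltk|gek] := ltnP k (size p); last first.
  by rewrite nth_default ?eqxx.
have/(pathP z)/(_ k ltk)/cube_adjP[j] := xp.
rewrite nth_index // => succz; rewrite succz => acti ->.
(* The image of [z] differs from [z] in component [j] only, so no other component is active. *)
have -> : i = j.
  by apply/eqP; apply: contraNT acti => /negbTE ij; rewrite ffunE ij addbF.
by rewrite -succz -[nth z p k]/(nth z (x :: p) k.+1) index_uniq.
Qed.

(** Since [f x] differs from [x] only in the first letter of [u], the run waits at [x] until that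
    letter is read, then moves to the next vertex; it cannot stop before the end of the path, where
    alone a fixed point is possible. *)
Lemma fixing_run_subseq f w x p u :
  fpath f x p -> induced_word x p u -> f (run f w x) = run f w x -> subseq u w.
Proof.
elim: w x p u => [|a w IH] x [|y p] [|i u] //=.
  by move=> /andP[/eqP <- _] /[swap] -> /andP[/forallP/(_ i)]; rewrite !eqxx.
move=> /andP[/eqP fx yp].
rewrite induced_word_cons => /andP[xiy yu]; have /differ_only_atP yE := xiy.
rewrite updateE fx yE ffunE; case: (eqVneq a i) => [->|ai] /=.
  rewrite addbT; case: eqP => [|_]; first by case: (x i).
  by rewrite -yE; apply: IH yp yu.
rewrite addbF eqxx; apply: (IH x (y :: p)) => //=.
  by rewrite fx eqxx.
by rewrite induced_word_cons xiy.
Qed.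

Lemma fixes_family_path_universal w :
  fixes_family w (@async_acyclic n) <-> path_universal w.
Proof.
split=> [fix_w u [x [p [xp uxp xu]]] | univ f].
  apply: fixing_run_subseq (path_network_fpath uxp) xu _.
  by apply: fix_w; apply: path_network_acyclic.
exact: path_universal_fixes.
Qed.

Lemma card_state : #|{: state n}| = 2 ^ n.
Proof. by rewrite card_ffun card_bool card_ord. Qed.

Lemma path_universal_exists : exists w, path_universal w.
Proof.
(* A path-word has fewer than [2 ^ n] letters; each is taken from its own copy of the alphabet. *)
exists (flatten (nseq (2 ^ n) (enum 'I_n))) => u [x [p [_ uxp xu]]].
have : size u <= 2 ^ n.
  rewrite (induced_word_size xu) -card_state ltnW //.
  by rewrite -[_.+1]/(size (x :: p)) -(card_uniqP uxp) max_card.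
elim: (2 ^ n) (u) => [|k IH] [|i v] // lev; first exact: sub0seq.
by rewrite -cat1s cat_subseq ?IH // sub1seq mem_enum.
Qed.

(** * The largest fixing length *)

Definition zero_state : state n := [ffun=> false].

Lemma acyclic_fixing_word f :
  async_acyclic f -> exists2 w, fixes w f & size w < 2 ^ n.
Proof.
move=> /acyclic_rank[r r_incr].
have moved x i : f x i != x i -> r x < r (flip i x).
  by move=> acti; apply: r_incr; apply/async_arcP; exists i.
(* [S] holds the non-fixed states still possible; an arc leaving [S] must end at a fixed point. *)
have emptied m (S : {set state n}) : #|S| = m ->
    (forall x, x \in S -> f x != x) ->
    (forall x i, x \in S -> f x i != x i ->
       flip i x \in S \/ f (flip i x) = flip i x) ->
    exists2 w, size w = m &
      forall x, x \in S \/ f x = x -> f (run f w x) = run f w x.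
  elim: m S => [|m IH] S cardS nonfixedS closedS.
    by exists [::] => // x []; rewrite // (cards0_eq cardS) inE.
  have [x0 x0S] : exists x0, x0 \in S by apply/card_gt0P; rewrite cardS.
  (* No arc from [S] enters a state of least rank, so reading a letter active at it removes it from
     [S] for good. *)
  have [x xS minx] := @arg_minnP _ x0 (fun y => y \in S) r x0S.
  have [i acti] := nonfixedP f x (nonfixedS x xS).
  have leave y j : y \in S -> f y j != y j -> flip j y != x.
    move=> yS actj; apply: contraTneq (moved y j actj) => ->.
    by rewrite -leqNgt minx.
  have [|y|y j|w sizew fixw] := IH (S :\ x).
  - by apply/eqP; rewrite -eqSS -cardS (cardsD1 x S) xS.
  - by rewrite !inE => /andP[_ /nonfixedS].
  - rewrite !inE => /andP[_ yS] actj; rewrite leave //.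
    exact: closedS.
  exists (i :: w); rewrite /= ?sizew // => y.
  case=> [yS|fy]; last by apply: fixw; right; rewrite update_fixed.
  apply: fixw; rewrite updateE !inE; case: ifPn => [fyi|actyi].
    by left; rewrite yS andbT; apply: contraNneq acti => <-.
  by rewrite leave //; apply: closedS.
have [x|x i _ _|w sizew fixw] := emptied _ [set x | f x != x] erefl.
- by rewrite inE.
- by rewrite inE; case: eqVneq; [right | left].
exists w => [x|]; first by apply: fixw; rewrite inE; case: eqVneq; [right | left].
(* A state of largest rank has no outgoing arc, hence is fixed; this saves one letter. *)
have [x _ maxx] := @arg_maxnP _ zero_state xpredT r isT.
rewrite sizew -card_state -cardsT proper_card // properT.
apply/eqP => /setP/(_ x); rewrite !inE => /nonfixedP[i /moved].
by apply/negP; rewrite -leqNgt; apply: maxx.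
Qed.

Lemma cube_adj_sym : symmetric (@cube_adj n).
Proof.
by move=> x y; apply/cube_adjP/cube_adjP => -[i ->]; exists i; rewrite flipK.
Qed.

Lemma cube_adj_flip i x y : cube_adj x y -> cube_adj (flip i x) (flip i y).
Proof.
case/cube_adjP=> j ->; apply/cube_adjP; exists j.
by apply/ffunP => k; rewrite !ffunE addbAC.
Qed.

(* Reflected Gray code: after the first [2 ^ k] states, repeat them in reverse
   order with component [k] flipped. *)
Lemma gray_code k :
  k <= n -> exists p,
    [/\ path (@cube_adj n) zero_state p, uniq (zero_state :: p),
        size (zero_state :: p) = 2 ^ k
      & forall x j, x \in zero_state :: p -> k <= j -> x j = false].
Proof.
elim: k => [|k IH] ltkn.
  by exists [::]; split=> // x j; rewrite inE => /eqP -> _; rewrite ffunE.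
have [p [adjp uniqp sizep lowp]] := IH (ltnW ltkn).
pose i := Ordinal ltkn; pose q := rev (map (flip i) (zero_state :: p)).
have qE : q = flip i (last zero_state p)
              :: rev (map (flip i) (belast zero_state p)).
  by rewrite /q lastI map_rcons rev_rcons.
exists (p ++ q); rewrite -cat_cons; split.
- rewrite cat_path adjp qE /=; apply/andP; split; first by apply/cube_adjP; exists i.
  rewrite -[path _ _ _]/(sorted _ (_ :: _)) -qE /q rev_sorted /= path_map.
  apply: sub_path adjp => x y xy; rewrite /= cube_adj_sym.
  exact: cube_adj_flip.
- rewrite cat_uniq uniqp rev_uniq map_inj_uniq ?uniqp ?andbT; last first.
    exact: can_inj (flipK i).
  (* The two halves are disjoint: component [k] is false in the first and true in the second. *)
  apply/hasPn => y; rewrite mem_rev => /mapP[x x_in ->].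
  apply/negP => /lowp/(_ (leqnn k : k <= i)).
  by rewrite ffunE eqxx (lowp x i).
- by rewrite size_cat size_rev size_map sizep addnn -mul2n expnS.
- move=> x j; rewrite mem_cat mem_rev => /orP[/lowp low /ltnW/low // | ].
  case/mapP=> y /lowp low -> ltkj; rewrite ffunE low ?(ltnW ltkj) //=.
  by apply/eqP => ji; rewrite ji ltnn in ltkj.
Qed.

Lemma acyclic_fixing_length_max :
  is_max (fun k => exists2 f : network n, async_acyclic f & fixing_length f k)
    (2 ^ n - 1).
Proof.
have short f : async_acyclic f -> exists2 w, fixes w f & size w <= 2 ^ n - 1.
  move=> /acyclic_fixing_word[w fixw ltw]; exists w => //.
  by rewrite -ltnS subn1 prednK ?expn_gt0.
split=> [|k [f /short[w fixw lew] [_ /(_ (size w))]]]; last first.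
  by move=> /(_ (ex_intro2 _ _ w fixw erefl)) /leq_trans; apply.
have [p [adjp uniqp sizep _]] := gray_code (leqnn n).
have [u indu] := cube_path_induced adjp.
have acyc := path_network_acyclic adjp uniqp.
(* The Gray code visits all [2 ^ n] states, so its word has [2 ^ n - 1] letters. *)
have long w : fixes w (path_network zero_state p) -> 2 ^ n - 1 <= size w.
  move=> fixw; rewrite -sizep subn1 /= -(induced_word_size indu).
  exact/size_subseq/(fixing_run_subseq (path_network_fpath uniqp) indu).
exists (path_network zero_state p) => //; split=> [|k [w /long lew <-] //].
have [w fixw lew] := short _ acyc; exists w => //.
by apply/eqP; rewrite eqn_leq lew long.
Qed.

End Networks.

Theorem theorem2 (n : nat) (hn : 1 <= n) :
  [/\ forall w : word n,
        fixes_family w (@async_acyclic n) <-> path_universal w,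
      exists m : nat, lambda_AG n m /\ Lambda n m
    & is_max
        (fun k => exists2 f : network n, async_acyclic f & fixing_length f k)
        (2 ^ n - 1)].
Proof.
split; [exact: fixes_family_path_universal | | exact: acyclic_fixing_length_max].
have [w univ] := path_universal_exists n.
have [|m Lm] := exists_least (P := fun k => exists2 w : word n,
  path_universal w & size w = k); first by exists (size w), w.
exists m; split=> //; have [[v univ_v <-] least_v] := Lm; split.
  by exists v => //; apply/fixes_family_path_universal.
move=> k [v' /fixes_family_path_universal univ_v' <-].
by apply: least_v; exists v'.
Qed.
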